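(* For every integer $d\ge 2$, there exists a graph $G$ satisfying $\delta^\star(G)=d$ and $\chi^\star_c(G) = 2d$. In particular, this is true for the complete bipartite graph $G=K_{d,\,((2d-1)!)^{d-1}}$.
   Context: Graphs are finite and simple. The degeneracy $\delta^\star(G)$ is the maximum over all subgraphs $H$ of $G$ of the minimum degree of $H$. A $k$-fold correspondence-cover of $G$ via $L$ is a graph $H$ together with a mapping $L:V(G)\to 2^{V(H)}$ such that the sets $L(v)$, $v\in V(G)$, partition $V(H)$, $|L(v)|=k$ for every $v$, for every edge $vv'\in E(G)$ the edges of $H$ between $L(v)$ and $L(v')$ form a (possibly empty) matching, and for distinct nonadjacent $v,v'$ there is no edge of $H$ between $L(v)$ and $L(v')$. An independent transversal of $H$ with respect to $L$ (a correspondence $L$-colouring) is a set consisting of exactly one vertex from each $L(v)$ having no two members $x\in L(v)$, $y\in L(v')$ (with $v\neq v'$) adjacent in $H$. A ($k$-fold) correspondence $L$-packing of $H$ is a collection of $k$ mutually disjoint correspondence $L$-colourings. The correspondence packing number $\chi^\star_c(G)$ is the least $k$ such that every $k$-fold correspondence-cover $H$ of $G$ via any $L$ admits a $k$-fold correspondence $L$-packing. *)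

(* Defs.v *)
From mathcomp Require Import all_boot.

Set Implicit Arguments.
Unset Strict Implicit.
Unset Printing Implicit Defensive.

Record sgraph := SGraph {
  vertex :> finType;
  adj : rel vertex;
  adj_sym : symmetric adj;
  adj_irrefl : irreflexive adj }.

(* A subgraph of [G] is a pair [P] of a vertex set [P.1] and a symmetric set
   [P.2] of ordered pairs: each edge is recorded in both orientations. *)
Definition subgraph (G : sgraph) (P : {set G} * {set G * G}) : bool :=
  [forall u, forall v, ((u, v) \in P.2) ==>
     [&& u \in P.1, v \in P.1, adj u v & (v, u) \in P.2]].

Definition degree (G : sgraph) (P : {set G} * {set G * G}) (v : G) : nat :=
  #|[set w | (v, w) \in P.2]|.

(* Every degree is at most [#|G|], so for a subgraph with a nonempty vertex set
   the default value of the iterated minimum plays no role. *)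
Definition min_degree (G : sgraph) (P : {set G} * {set G * G}) : nat :=
  \big[minn/#|G|]_(v in P.1) degree P v.

Definition degeneracy (G : sgraph) : nat :=
  \max_(P : {set G} * {set G * G} | subgraph P && (P.1 != set0)) min_degree P.

Definition matching_between (H : sgraph) (A B : {set H}) : Prop :=
  (forall x y y', x \in A -> y \in B -> y' \in B ->
     adj x y -> adj x y' -> y = y') /\
  (forall x x' y, x \in A -> x' \in A -> y \in B ->
     adj x y -> adj x' y -> x = x').

(* Edges of [H] inside a single [L v] are unrestricted. *)
Definition correspondence_cover (k : nat) (G H : sgraph) (L : G -> {set H}) :
    Prop :=
  [/\ forall x : H, exists! v : G, x \in L v,
      forall v : G, #|L v| = k,
      forall v v' : G, adj v v' -> matching_between (L v) (L v')
    & forall v v' : G, v != v' -> ~~ adj v v' ->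
        forall x y : H, x \in L v -> y \in L v' -> ~~ adj x y].

Definition correspondence_colouring (G H : sgraph) (L : G -> {set H})
    (I : {set H}) : Prop :=
  (forall v : G, #|I :&: L v| = 1) /\
  (forall (v v' : G) (x y : H), v != v' ->
     x \in I :&: L v -> y \in I :&: L v' -> ~~ adj x y).

Definition correspondence_packing (k : nat) (G H : sgraph) (L : G -> {set H})
    (P : {set {set H}}) : Prop :=
  [/\ #|P| = k, trivIset P
    & forall I : {set H}, I \in P -> correspondence_colouring L I].

Definition packable (G : sgraph) (k : nat) : Prop :=
  forall (H : sgraph) (L : G -> {set H}), correspondence_cover k L ->
    exists P : {set {set H}}, correspondence_packing k L P.

(* The least [k] is taken over positive integers: [packable G 0] always holds,
   since the empty collection is a packing of any 0-fold cover. *)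
Definition correspondence_packing_number (G : sgraph) (k : nat) : Prop :=
  [/\ 0 < k, packable G k & forall j : nat, 0 < j -> packable G j -> k <= j].

Definition bipartite_adj (m n : nat) : rel ('I_m + 'I_n)%type :=
  fun u v => match u, v with
             | inl _, inr _ | inr _, inl _ => true
             | _, _ => false
             end.

Lemma bipartite_adj_sym m n : symmetric (@bipartite_adj m n).
Proof. by case=> ? [] ?. Qed.

Lemma bipartite_adj_irrefl m n : irreflexive (@bipartite_adj m n).
Proof. by case. Qed.

Definition complete_bipartite (m n : nat) : sgraph :=
  SGraph (@bipartite_adj_sym m n) (@bipartite_adj_irrefl m n).

(* Main.v *)
Require Import Defs.
From mathcomp Require Import all_boot perm.
From mathcomp Require Import zify.

(** Upper bound.  Fix a cover of [K_(m, n)] with lists of size [2m].  Vertices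
    on the left side are pairwise nonadjacent, so any enumeration of their lists
    packs them.  Given that packing, a right vertex [b] needs a bijection from
    the [2m] colourings to [L b] avoiding conflicts.  Each of the [m]
    neighbours of [b] is joined to it by a matching, hence each colouring
    conflicts with at most [m] colours and each colour with at most [m]
    colourings: the compatibility relation is bipartite on [2m + 2m] points
    with all degrees at least [m], and has a perfect matching
    ([ore_perfect_matching]).  Right vertices are pairwise nonadjacent, so they
    are treated independently.

    Lower bound.  Let [0 < k < 2d].  Label the [k] colourings of a packing by
    the colour they give to the first left vertex; the other [d - 1] left
    vertices then determine a tuple of [d - 1] permutations of the colours.  As
    there are at least [(k`!) ^ (d - 1)] right vertices, each tuple can be given
    its own right vertex [b], whose matchings are designed to defeat it: with
    [m = min(d, k)], in colouring [j < m] the [m] first left vertices forbid at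
    [b] the colours [j, j + 1, ..., j + m - 1] modulo [m], that is all the
    colours below [m].  These [m] colourings are left with only [k - m < m]
    colours at [b], and they must use distinct ones ([not_packable]). *)

Set Implicit Arguments.
Unset Strict Implicit.
Unset Printing Implicit Defensive.

(** * Perfect matchings under an Ore condition *)

(** Take a permutation with the largest number of good positions.  If
    [x] is a bad position, the condition yields a position [z] such that
    swapping the values at [x] and [z] makes both good, contradicting the
    choice. *)
Lemma ore_perfect_matching (T : finType) (good : rel T) :
    (forall x y, ~~ good x y ->
       #|T| <= #|[set z | good x z]| + #|[set z | good z y]|) ->
  exists s : {perm T}, forall x, good x (s x).
Proof.
move=> ore.
pose fit (s : {perm T}) := [set x | good x (s x)].
case: (@arg_maxnP _ (1%g : {perm T}) predT (fun s => #|fit s|) isT) => s _ smax.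
exists s => x; apply/negPn/negP => bad_x.
pose A := [set z | good x (s z)]; pose B := [set z | good z (s x)].
have cardA : #|A| = #|[set z | good x z]|.
  rewrite -(card_imset _ (@perm_inj _ s)); apply: eq_card => y.
  rewrite inE; apply/imsetP/idP => [[z] | gy]; first by rewrite inE => gz ->.
  by exists ((s^-1)%g y); rewrite ?inE permKV.
have AB0 : A :&: B != set0.
  apply/negP => /eqP AB0; have := cardsUI A B.
  rewrite AB0 cards0 addn0 cardA => cardU.
  have := leq_trans (ore _ _ bad_x) (eq_leq (esym cardU)).
  have : A :|: B \proper setT.
    by apply/properP; split; [apply: subsetT | exists x; rewrite ?inE ?orbb].
  by move/proper_card; rewrite cardsT => lt /(leq_trans lt); rewrite ltnn.
case/set0Pn: AB0 => z /setIP[]; rewrite !inE => gxz gzx.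
have := smax (tperm x z * s)%g isT; rewrite /= leqNgt => /negP; apply.
apply: proper_card; apply/properP; split.
  apply/subsetP => y; rewrite !inE permM.
  by case: tpermP => [-> | -> | _ _].
by exists x; rewrite !inE ?permM ?tpermL.
Qed.

(** * Packings as families of enumerations of the lists *)

(** A packing with its colourings numbered: [p v j] is the vertex of [L v]
    chosen by the [j]-th colouring. *)
Definition packing_family (k : nat) (G H : sgraph) (L : G -> {set H})
    (p : G -> 'I_k -> H) : Prop :=
  [/\ forall v, injective (p v),
      forall v j, p v j \in L v
    & forall j v v', v != v' -> ~~ adj (p v j) (p v' j)].

Lemma cover_inj k (G H : sgraph) (L : G -> {set H}) x v v' :
  correspondence_cover k L -> x \in L v -> x \in L v' -> v = v'.
Proof.
case=> part _ _ _ xv xv'; have [w [_ uw]] := part x.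
by rewrite -(uw v) ?(uw v').
Qed.

(** A vertex of [G] has to exist: otherwise all colourings are empty, hence
    equal. *)
Lemma packing_of_family k (G H : sgraph) (L : G -> {set H}) p (v0 : G) :
    correspondence_cover k L -> packing_family (k := k) L p ->
  exists P, correspondence_packing k L P.
Proof.
move=> covL [pinj pL padj]; pose I j := [set p v j | v : G].
have memI j v x : x \in I j -> x \in L v -> x = p v j.
  by case/imsetP=> w _ -> /(cover_inj covL (pL w j)) ->.
have pI v j : p v j \in I j by apply: imset_f.
have Idisj x j j' : x \in I j -> x \in I j' -> j = j'.
  case/imsetP=> v _ ->{x} pI'; apply: (pinj v).
  exact: memI pI' (pL v j).
exists [set I j | j : 'I_k]; split.
- rewrite card_imset ?card_ord // => j j' eqI.
  by apply: (Idisj (p v0 j)); rewrite // -eqI.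
- apply/trivIsetP => _ _ /imsetP[j _ ->] /imsetP[j' _ ->] neqI.
  apply/pred0P => x /=; apply/negP => /andP[xj xj'].
  by rewrite (Idisj _ _ _ xj xj') eqxx in neqI.
- move=> _ /imsetP[j _ ->]; split.
    move=> v; rewrite -[RHS](cards1 (p v j)); apply: eq_card => x.
    rewrite in_setI in_set1; apply/andP/eqP => [[xI xL] | ->]; first exact: memI.
    by rewrite pI pL.
  move=> v v' x y neq /setIP[xI xL] /setIP[yI yL].
  by rewrite (memI _ _ _ xI xL) (memI _ _ _ yI yL) padj.
Qed.

Lemma family_of_packing k (G H : sgraph) (L : G -> {set H}) P :
  correspondence_packing k L P -> exists p, packing_family (k := k) L p.
Proof.
case=> cardP triv colP.
pose I (j : 'I_k) := enum_val (cast_ord (esym cardP) j).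
have IP j : I j \in P by apply: enum_valP.
have Iinj : injective I by move=> j j' /enum_val_inj/cast_ord_inj.
have pickI v : exists q : 'I_k -> H, forall j, q j \in I j :&: L v.
  apply: (fin_all_exists (P := fun j x => x \in I j :&: L v)) => j.
  have /eqP/cards1P[x Ix] := (colP _ (IP j)).1 v.
  by exists x; rewrite Ix set11.
have [p pP] := fin_all_exists pickI.
exists p; split=> [v j j' eqp | v j | j v v' neq].
- apply: Iinj; apply/eqP/negPn/negP => neqI.
  have /pred0P/(_ (p v j))/= := trivIsetP triv _ _ (IP j) (IP j') neqI.
  by have /setIP[-> _] := pP v j; rewrite eqp; have /setIP[-> _] := pP v j'.
- by have /setIP[] := pP v j.
- exact: (colP _ (IP j)).2 neq (pP v j) (pP v' j).
Qed.

Lemma matching_between_sym (H : sgraph) (A B : {set H}) :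
  matching_between A B -> matching_between B A.
Proof.
move=> [m1 m2]; split=> [x y y' xB yA y'A | x x' y xB x'B yA].
  by rewrite ![adj x _]adj_sym; apply: m2.
by rewrite ![adj _ y]adj_sym; apply: m1.
Qed.

Lemma card_le1_set (T : finType) (A : {set T}) :
  {in A &, forall x y, x = y} -> #|A| <= 1.
Proof. by move=> eqA; apply/card_le1_eqP => x y xA yA; apply: eqA. Qed.

(** * The upper bound *)

(** Bounds both kinds of conflict at a right vertex: by the two halves of the
    matching condition, each left vertex makes a given colouring clash with at
    most one colour, and a given colour with at most one colouring. *)
Lemma card_exists_le m (T : finType) (R : 'I_m -> {pred T}) :
    (forall a, {in R a &, forall x y, x = y}) ->
  #|[set x | [exists a, x \in R a]]| <= m.
Proof.
move=> R1; have -> : [set x | [exists a, x \in R a]] =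
    \bigcup_(a : 'I_m) [set x | x \in R a].
  apply/setP => x; rewrite inE; apply/existsP/bigcupP => [[a xa]|[a _]].
    by exists a; rewrite ?inE.
  by rewrite inE; exists a.
rewrite (leq_trans (n := \sum_(a : 'I_m) 1)) //; last first.
  by rewrite sum1_card card_ord.
apply: (big_ind2 (fun (A : {set T}) s => #|A| <= s)) => [|A s B t lA lB|a _].
- by rewrite cards0.
- by rewrite (leq_trans (leq_card_setU A B).1) // leq_add.
- by apply: card_le1_set => x y; rewrite !inE; apply: R1.
Qed.

Lemma packable_complete_bipartite m n :
  0 < m -> packable (complete_bipartite m n) (2 * m).
Proof.
move=> m_gt0 H L covL; set G := complete_bipartite m n.
have [_ cardL matchL nonadjL] := covL.
pose e (v : G) (j : 'I_(2 * m)) : H := enum_val (cast_ord (esym (cardL v)) j).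
have eL v j : e v j \in L v by apply: enum_valP.
have einj v : injective (e v) by move=> j j' /enum_val_inj/cast_ord_inj.
pose bad b a j c := adj (e (inl a) j) (e (inr b) c).
have right_perm b : exists s : {perm 'I_(2 * m)},
    forall j, ~~ [exists a, bad b a j (s j)].
  apply: (ore_perfect_matching
            (good := fun j c => ~~ [exists a, bad b a j c])) => j c _.
  have half (A : {set 'I_(2 * m)}) : #|A| <= m -> m <= #|~: A|.
    by move=> le; have := cardsC A; rewrite card_ord; lia.
  have -> : [set z | ~~ [exists a, bad b a j z]] =
      ~: [set z | [exists a, z \in bad b a j]].
    by apply/setP => z; rewrite !inE.
  have -> : [set z | ~~ [exists a, bad b a z c]] =
      ~: [set z | [exists a, z \in [pred y | bad b a y c]]].
    by apply/setP => z; rewrite !inE.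
  apply: (leq_trans (n := m + m)); first by rewrite card_ord addnn mul2n.
  apply: leq_add; apply: half; apply: card_exists_le.
    move=> a z z' adjz adjz'; apply: (einj (inr b)).
    have [fn _] := matchL (inl a) (inr b) isT.
    exact: fn (eL _ _) (eL _ _) (eL _ _) adjz adjz'.
  move=> a z z' adjz adjz'; apply: (einj (inl a)).
  have [_ fn] := matchL (inl a) (inr b) isT.
  exact: fn (eL _ _) (eL _ _) (eL _ _) adjz adjz'.
have [s sP] := fin_all_exists right_perm.
pose p (v : G) j := match v with inl a => e (inl a) j
                               | inr b => e (inr b) (s b j) end.
apply: (packing_of_family (p := p) (inl (Ordinal m_gt0) : G) covL); split.
- by case=> [a | b] j j' /= /einj // /perm_inj.
- by case=> [a | b] j /=.
- move=> j [a | b] [a' | b'] neq /=.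
  + exact: nonadjL neq isT _ _ (eL _ _) (eL _ _).
  + by apply: contra (sP b' j) => ?; apply/existsP; exists a.
  + rewrite adj_sym.
    by apply: contra (sP b j) => ?; apply/existsP; exists a'.
  + exact: nonadjL neq isT _ _ (eL _ _) (eL _ _).
Qed.

(** * The lower bound *)

(** The colour [s j] of the [a]-th left vertex forbids the colour [j + a] modulo
    [m], for [j < m] only.  With [s] the permutation giving the colour of that
    vertex in each colouring, colouring [j] thus forbids [j + a]. *)
Definition latin_link k (m : nat) (s : {perm 'I_k}) (a : nat) : rel 'I_k :=
  fun c c' => ((s^-1)%g c < m) && (c' == ((s^-1)%g c + a) %% m :> nat).

Lemma latin_link_functional k m (s : {perm 'I_k}) a c c1 c2 :
  latin_link m s a c c1 -> latin_link m s a c c2 -> c1 = c2.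
Proof.
by case/andP=> _ /eqP e1 /andP[_ /eqP e2]; apply: val_inj; rewrite /= e1 e2.
Qed.

Lemma latin_link_injective k m (s : {perm 'I_k}) a c1 c2 c :
  latin_link m s a c1 c -> latin_link m s a c2 c -> c1 = c2.
Proof.
case/andP=> lt1 /eqP ec /andP[lt2].
rewrite ec eqn_modDr !modn_small // => /eqP eqs.
by apply: (@perm_inj _ (s^-1)%g); apply: val_inj.
Qed.

Section LatinCover.

Variables (d n k m : nat) (s : 'I_n -> 'I_d -> {perm 'I_k}).
Let G := complete_bipartite d n.

Definition latin_adj : rel (G * 'I_k)%type :=
  fun x y => match x.1, y.1 with
             | inl a, inr b => latin_link m (s b a) a x.2 y.2
             | inr b, inl a => latin_link m (s b a) a y.2 x.2
             | _, _ => false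
             end.

Lemma latin_adj_sym : symmetric latin_adj.
Proof. by case=> [[a|b] c] [[a'|b'] c']. Qed.

Lemma latin_adj_irrefl : irreflexive latin_adj.
Proof. by case=> [[a|b] c]. Qed.

Definition latin_graph : sgraph := SGraph latin_adj_sym latin_adj_irrefl.

Definition latin_list (v : G) : {set latin_graph} := [set x | x.1 == v].

Lemma latin_cover : correspondence_cover k latin_list.
Proof.
split.
- move=> x; exists x.1; split; first by rewrite inE.
  by move=> v; rewrite inE => /eqP.
- move=> v; have -> : latin_list v = [set (v, c) | c : 'I_k].
    apply/setP => [[w c]]; rewrite inE /=.
    apply/eqP/imsetP => [-> | [c' _ [->]]] //.
    by exists c.
  by rewrite card_imset ?card_ord // => c c' [].
- have match_lr a b : matching_between (latin_list (inl a)) (latin_list (inr b)).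
    split=> [[v c] [w c1] [w' c2] | [v c1] [v' c2] [w c]];
      rewrite !inE /= => /eqP-> /eqP-> /eqP-> l1 l2; congr pair.
      exact: latin_link_functional l1 l2.
    exact: latin_link_injective l1 l2.
  by case=> [a|b] [a'|b'] //= _; last apply: matching_between_sym.
- move=> [a|b] [a'|b'] // _ _ [v c] [w c'];
    by rewrite !inE /= => /eqP-> /eqP->.
Qed.

End LatinCover.

Lemma finite_surjection (T : finType) (t0 : T) n :
  #|T| <= n -> exists f : 'I_n -> T, forall t, exists b, f b = t.
Proof.
move=> leTn; exists (fun b => nth t0 (enum T) b) => t.
have lt : index t (enum T) < n.
  by rewrite (leq_trans _ leTn) // cardE index_mem mem_enum.
by exists (Ordinal lt); rewrite /= nth_index ?mem_enum.
Qed.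

Lemma card_ord_lt k m : m <= k -> #|[set j : 'I_k | j < m]| = m.
Proof.
move=> le_mk; rewrite -[RHS]card_ord -cardsT.
have wid_inj : injective (widen_ord le_mk).
  by move=> i i' /(congr1 val) eqi; apply: val_inj.
rewrite -(card_imset _ wid_inj).
apply: eq_card => j; rewrite inE; apply/idP/imsetP => [lt | [i _ ->]] //=.
by exists (Ordinal lt); rewrite ?inE //; apply: val_inj.
Qed.

(** All sizes [k < 2d] are excluded separately, as packability is not obviously
    monotone in [k]; taking [m = min(d, k)] treats them alike, since it gives
    both [m <= d] and [k - m < m]. *)
Lemma not_packable d n k :
    0 < k < 2 * d -> (k`!) ^ (d - 1) <= n ->
  ~ packable (complete_bipartite d n) k.
Proof.
case: d => [|d]; first by rewrite muln0 ltn0 andbF.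
case/andP=> k_gt0 lt_k; rewrite subn1 /= => le_n packG.
pose T := {ffun 'I_d -> {perm 'I_k}}.
have cardT : #|T| <= n by rewrite card_ffun card_Sn card_ord.
have [f f_surj] := finite_surjection ([ffun=> 1%g] : T) cardT.
(* The renumbering makes the permutation of the first left vertex trivial, so
   only the [d] others are indexed by [T]. *)
pose s b (a : 'I_d.+1) : {perm 'I_k} := oapp (f b) 1%g (unlift ord0 a).
pose m := minn d.+1 k.
have le_mk : m <= k by apply: geq_minr.
have le_md : m <= d.+1 by apply: geq_minl.
have m_gt0 : 0 < m by rewrite leq_min.
have [P /family_of_packing[p [pinj pL padj]]] := packG _ _ (latin_cover m s).
pose col v j := (p v j).2.
have pE v j : p v j = (v, col v j).
  by have := pL v j; rewrite inE /col => /eqP; case: (p v j) => w c /= ->.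
have col_inj v : injective (col v).
  by move=> j j' eqc; apply: (pinj v); rewrite !pE eqc.
pose pi v := perm (@col_inj v).
(* Colourings are renumbered by the colour they give to [inl ord0]. *)
pose rel_pi a := ((pi (inl ord0))^-1 * pi (inl a))%g.
have [b fb] := f_surj [ffun a => rel_pi (lift ord0 a)].
have sb a : s b a = rel_pi a.
  rewrite /s fb; case: unliftP => [a' -> | ->] /=; first by rewrite ffunE.
  by rewrite /rel_pi mulVg.
pose t := ((pi (inl ord0))^-1 * pi (inr b))%g.
pose A := [set j : 'I_k | j < m].
(* If [t j < m] for some [j < m], then [t j] is [j + a] modulo [m] for some
   [a < m], so it is forbidden by the [a]-th left vertex. *)
have tA : t @: A \subset ~: A.
  apply/subsetP => x /imsetP[j]; rewrite !inE => lt_jm ->; apply/negP => lt_tm.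
  have lt_a : (t j + (m - j)) %% m < d.+1.
    by rewrite (leq_trans _ le_md) // ltn_pmod.
  pose a := Ordinal lt_a.
  have /negP[] := padj ((pi (inl ord0))^-1 j)%g (inl a) (inr b) isT.
  have piE v : col v ((pi (inl ord0))^-1 j)%g =
      ((pi (inl ord0))^-1 * pi v)%g j by rewrite permM [in RHS]permE.
  rewrite !pE !piE /= /latin_adj /= /latin_link sb permK lt_jm /=.
  rewrite -/t modnDmr addnCA subnKC ?(ltnW lt_jm) // modnDr modn_small //.
have := subset_leq_card tA; rewrite card_imset; last exact: perm_inj.
have := cardsC A; rewrite card_ord_lt // card_ord /m.
lia.
Qed.

(** * Degeneracy of complete bipartite graphs *)

Lemma min_degree_le (G : sgraph) (P : {set G} * {set G * G}) v :
  v \in P.1 -> min_degree P <= degree P v.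
Proof.
move=> vP; rewrite /min_degree; have := mem_index_enum v.
elim: (index_enum G) => //= w r IHr; rewrite inE big_cons => /orP[/eqP<- | vr].
  by rewrite vP geq_minl.
by case: ifP => _; rewrite ?geq_min IHr ?orbT.
Qed.

(** Every edge meets the right side, where degrees are at most [d]: a subgraph
    with no right vertex has no edge at all.  Conversely, the whole graph has
    minimum degree [min(d, n)]. *)
Lemma degeneracy_complete_bipartite d n :
  d <= n -> degeneracy (complete_bipartite d n) = d.
Proof.
move=> le_dn; set G := complete_bipartite d n.
apply/eqP; rewrite eqn_leq; apply/andP; split.
  apply/bigmax_leqP => P /andP[/forallP subP /set0Pn[v vP]].
  have edgeP u w : (u, w) \in P.2 -> (w \in P.1) && adj u w.
    by move=> uw; have /forallP/(_ w)/implyP/(_ uw)/and4P[_ -> ->] := subP u.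
  have [/existsP[b bP] | noR] := boolP [exists b : 'I_n, (inr b : G) \in P.1].
    apply: leq_trans (min_degree_le bP) _.
    rewrite -[X in _ <= X]card_ord -cardsT.
    apply: leq_trans (leq_imset_card (inl : 'I_d -> G) _).
    apply: subset_leq_card; apply/subsetP => w; rewrite inE => /edgeP/andP[_].
    by case: w => // a _; apply: imset_f.
  apply: leq_trans (min_degree_le vP) _.
  rewrite /degree (_ : [set w | _] = set0) ?cards0 //.
  apply/setP => w; rewrite !inE; apply/negP => /edgeP/andP[wP].
  case: w wP => [a|b] wP; last by move/existsP: noR; case; exists b.
  case: v vP => // b bP; by move/existsP: noR; case; exists b.
case: (posnP d) => [-> // | d_gt0].
pose P : {set G} * {set G * G} := (setT, [set e | adj e.1 e.2]).
have subP : subgraph P && (P.1 != set0).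
  apply/andP; split; last first.
    by apply/set0Pn; exists (inl (Ordinal d_gt0)); rewrite inE.
  apply/forallP => u; apply/forallP => w; apply/implyP; rewrite !inE /= => uw.
  by rewrite uw /= bipartite_adj_sym.
apply: (leq_trans (n := min_degree P)); last first.
  by rewrite /degeneracy (bigD1 P subP) leq_maxl.
rewrite /min_degree; apply: (big_ind (leq d)) => [|x y dx dy|v _].
- by rewrite card_sum !card_ord leq_addr.
- by rewrite leq_min dx.
- rewrite /degree; case: v => [a|b].
    rewrite (leq_trans le_dn) // -{1}(card_ord n) -cardsT.
    rewrite -(card_imset _ (@inr_inj 'I_d 'I_n)); apply: subset_leq_card.
    by apply/subsetP => _ /imsetP[b _ ->]; rewrite !inE.
  rewrite -{1}(card_ord d) -cardsT.
  rewrite -(card_imset _ (@inl_inj 'I_d 'I_n)); apply: subset_leq_card.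
  by apply/subsetP => _ /imsetP[a _ ->]; rewrite !inE.
Qed.

(** * The packing number *)

Lemma packing_number_complete_bipartite d n :
    0 < d -> ((2 * d - 1)`!) ^ (d - 1) <= n ->
  correspondence_packing_number (complete_bipartite d n) (2 * d).
Proof.
move=> d_gt0 le_n; split; first by rewrite muln_gt0.
  exact: packable_complete_bipartite.
move=> j j_gt0 packj; rewrite leqNgt; apply/negP => lt_j.
apply: (@not_packable d n j) packj; first by rewrite j_gt0.
apply: leq_trans le_n.
have le_fact : j`! <= (2 * d - 1)`!.
  have : j <= 2 * d - 1 by lia.
  by rewrite leq_eqVlt => /orP[/eqP-> // | lt]; rewrite ltnW ?ltn_fact.
by case: (posnP (d - 1)) => [-> // | d1_gt0]; rewrite leq_exp2r.
Qed.

Theorem proposition24 (d : nat) (hd : 2 <= d) :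
  (exists G : sgraph,
     degeneracy G = d /\ correspondence_packing_number G (2 * d)) /\
  (degeneracy (complete_bipartite d (((2 * d - 1)`!) ^ (d - 1))) = d /\
   correspondence_packing_number
     (complete_bipartite d (((2 * d - 1)`!) ^ (d - 1))) (2 * d)).
Proof.
have le_d : d <= ((2 * d - 1)`!) ^ (d - 1).
  apply: (leq_trans (n := (2 * d - 1)`! ^ 1)).
    by rewrite expn1 (leq_trans _ (fact_geq _)) //; lia.
  by apply: leq_pexp2l; [apply: fact_gt0 | lia].
have d_gt0 : 0 < d by lia.
have main := conj (degeneracy_complete_bipartite le_d)
                  (packing_number_complete_bipartite d_gt0 (leqnn _)).
by split; [exists (complete_bipartite d (((2 * d - 1)`!) ^ (d - 1))) |].
Qed.
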